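(* Let $p=yu+z^2$, $v=xz+yp$, $w=x^2u-2xzp-yp^2$ in $\mathbb{C}[x][y,z,u]=\mathbb{C}[x]^{[3]}$, and let $f=y+xQ$ with $Q \in \mathbb{C}[x][v,w]$ (a Vénéreau-type polynomial). Then for each $c \in \mathbb{C}$, $f-c$ is a $\mathbb{C}[x]$-hyperplane of $\mathbb{C}[x]^{[3]}$; that is, $\mathbb{C}[x]^{[3]}/(f-c)\cong\mathbb{C}[x]^{[2]}$ as $\mathbb{C}[x]$-algebras.
   Context: For a commutative ring $A$ with one, $A^{[n]}$ denotes the polynomial ring in $n$ variables over $A$. *)

(* Defs.v *)
From HB Require Import structures.
From mathcomp Require Import all_boot all_algebra.
From mathcomp Require Import boolp reals.
From mathcomp Require Import complex mpoly.

Set Implicit Arguments.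
Unset Strict Implicit.
Unset Printing Implicit Defensive.

Import GRing.Theory.
Local Open Scope ring_scope.
Local Open Scope quotient_scope.

(* [{ideal_quot I}] only carries a ring structure for a proper ideal [I], and
   no structure of module over a base ring.  The quotient of a commutative
   algebra by an arbitrary principal ideal, possibly the whole algebra, is
   therefore a [comPzRingType], with the module structure inherited from the
   algebra. *)
Section PrincipalQuotient.
Variables (A : comNzRingType) (B : comAlgType A) (g : B).

Definition principal_ideal : {pred B} := fun h => `[< exists q, h = q * g >].

Lemma principal_idealP h : reflect (exists q, h = q * g) (h \in principal_ideal).
Proof. exact: asboolP. Qed.

Lemma principal_ideal_zmod_closed : zmod_closed principal_ideal.
Proof.
split; first by apply/principal_idealP; exists 0; rewrite mul0r.
move=> h1 h2 /principal_idealP[q1 ->] /principal_idealP[q2 ->].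
by apply/principal_idealP; exists (q1 - q2); rewrite mulrBl.
Qed.

HB.instance Definition _ :=
  GRing.isZmodClosed.Build B principal_ideal principal_ideal_zmod_closed.

Lemma principal_idealM q h : h \in principal_ideal -> q * h \in principal_ideal.
Proof.
move=> /principal_idealP[r ->]; apply/principal_idealP.
by exists (q * r); rewrite mulrA.
Qed.

Lemma principal_idealZ a h : h \in principal_ideal -> a *: h \in principal_ideal.
Proof. by rewrite -[a *: h]mulr_algl; apply: principal_idealM. Qed.

Definition principal_quot : Type := Quotient.quot principal_ideal.

HB.instance Definition _ := GRing.Zmodule.on principal_quot.
HB.instance Definition _ := Quotient.on principal_quot.

Local Notation P := principal_quot (only parsing).

Lemma principal_quot_eqP (h1 h2 : B) :
  reflect (\pi_P h1 = \pi_P h2) (h1 - h2 \in principal_ideal).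
Proof. by rewrite (Quotient.idealrBE principal_ideal); apply: eqP. Qed.

Lemma principal_quot_piD (h1 h2 : B) : \pi_P (h1 + h2) = \pi_P h1 + \pi_P h2.
Proof. exact: (@pi_addr _ _ _ _ _ (Quotient.quot principal_ideal)). Qed.

Definition principal_quot_one : P := lift_cst P 1.
Definition principal_quot_mul : P -> P -> P := lift_op2 P *%R.
Definition principal_quot_scale (a : A) : P -> P := lift_op1 P ( *:%R a).

Lemma principal_quot_piM (h1 h2 : B) :
  principal_quot_mul (\pi_P h1) (\pi_P h2) = \pi_P (h1 * h2).
Proof.
unlock principal_quot_mul; apply/principal_quot_eqP; set r1 := repr _; set r2 := repr _.
have d1 : r1 - h1 \in principal_ideal by apply/principal_quot_eqP; rewrite reprK.
have d2 : r2 - h2 \in principal_ideal by apply/principal_quot_eqP; rewrite reprK.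
have -> : r1 * r2 - h1 * h2 = r2 * (r1 - h1) + h1 * (r2 - h2).
  by rewrite !mulrBr [r2 * r1]mulrC [r2 * h1]mulrC addrA subrK.
by rewrite rpredD ?principal_idealM.
Qed.

Lemma principal_quot_piZ a (h : B) :
  principal_quot_scale a (\pi_P h) = \pi_P (a *: h).
Proof.
unlock principal_quot_scale; apply/principal_quot_eqP; rewrite -scalerBr principal_idealZ //.
by apply/principal_quot_eqP; rewrite reprK.
Qed.

Lemma principal_quot_mulA : associative principal_quot_mul.
Proof.
move=> s t u; rewrite -[s]reprK -[t]reprK -[u]reprK.
by rewrite !principal_quot_piM mulrA.
Qed.

Lemma principal_quot_mulC : commutative principal_quot_mul.
Proof.
by move=> s t; rewrite -[s]reprK -[t]reprK !principal_quot_piM mulrC.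
Qed.

Lemma principal_quot_mul1 : left_id principal_quot_one principal_quot_mul.
Proof. by move=> s; rewrite -[s]reprK /principal_quot_one; unlock; rewrite principal_quot_piM mul1r. Qed.

Lemma principal_quot_mulD : left_distributive principal_quot_mul +%R.
Proof.
move=> s t u; rewrite -[s]reprK -[t]reprK -[u]reprK.
by rewrite -principal_quot_piD !principal_quot_piM mulrDl principal_quot_piD.
Qed.

HB.instance Definition _ := GRing.Zmodule_isComPzRing.Build principal_quot
  principal_quot_mulA principal_quot_mulC principal_quot_mul1
  principal_quot_mulD.

Lemma principal_quot_scaleA a b s :
  principal_quot_scale a (principal_quot_scale b s)
  = principal_quot_scale (a * b) s.
Proof. by rewrite -[s]reprK !principal_quot_piZ scalerA. Qed.

Lemma principal_quot_scale1 : left_id 1 principal_quot_scale.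
Proof. by move=> s; rewrite -[s]reprK principal_quot_piZ scale1r. Qed.

Lemma principal_quot_scaleDr : right_distributive principal_quot_scale +%R.
Proof.
move=> a s t; rewrite -[s]reprK -[t]reprK -principal_quot_piD.
by rewrite !principal_quot_piZ scalerDr principal_quot_piD.
Qed.

Lemma principal_quot_scaleDl s :
  {morph principal_quot_scale^~ s : a b / a + b}.
Proof.
move=> a b; rewrite -[s]reprK !principal_quot_piZ scalerDl.
exact: principal_quot_piD.
Qed.

HB.instance Definition _ := GRing.Zmodule_isLmodule.Build A principal_quot
  principal_quot_scaleA principal_quot_scale1 principal_quot_scaleDr
  principal_quot_scaleDl.

End PrincipalQuotient.

(* [{lrmorphism _ -> _}] requires a nontrivial source ring, hence an algebra
   morphism out of the quotient is a scalable ring morphism. *)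
Definition hyperplane (A : comNzRingType) (n : nat) (g : {mpoly A[n.+1]}) : Prop :=
  exists phi : {rmorphism principal_quot g -> {mpoly A[n]}},
    scalable phi /\ bijective phi.

(* The elements of A[v, w], the A-subalgebra of A^[n] generated by v and w, are
   the polynomial expressions in v and w with coefficients in A. *)
Definition subalgebra2 (A : comNzRingType) (n : nat) (v w : {mpoly A[n]})
    (q : {mpoly A[n]}) : Prop :=
  exists h : {mpoly A[2]}, q = h \mPo [tuple v; w].

Section VenereauPolynomials.
Variable K : comNzRingType.
Local Notation S := {mpoly {poly K}[3]}.

Definition ven_x : S := ('X : {poly K})%:MP.
Definition ven_y : S := 'X_0.
Definition ven_z : S := 'X_1.
Definition ven_u : S := 'X_2.

Local Notation x := ven_x.
Local Notation y := ven_y.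
Local Notation z := ven_z.
Local Notation u := ven_u.

Definition ven_p : S := y * u + z ^+ 2.
Definition ven_v : S := x * z + y * ven_p.
Definition ven_w : S := x ^+ 2 * u - 2%:R * x * z * ven_p - y * ven_p ^+ 2.

Definition venereau_type (f : S) : Prop :=
  exists2 Q : S, subalgebra2 ven_v ven_w Q & f = y + x * Q.

End VenereauPolynomials.

(* Main.v *)
(* Fix c and put g = f - c.  The ring k[y,z,u]/(g), with k = K[x], is generated
   over k[x^-1] by v and w, in view of the identities
     x^2 p = y w + v^2,   x z = v - y p,   x^2 u = w + 2 x z p + y p^2,
   and only the fibre over x = 0, where y = c, needs care.
   If c <> 0, then x^3 z = x^2 v - v^2 y - w y^2 with y = c - x Q(v, w), and
   Hensel's lemma solves this equation modulo x^3 as w = b(v); the variables are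
   v and (w - b(v)) / x^3.
   If c = 0, then v and w are divisible by x modulo g, and v / x, w / x generate
   together with u.  The Nagata automorphism with parameter q = Q(0, 0) sends
   (v / x, w / x) to a pair (a, b) with b divisible by x; the variables are a
   and b / x. *)
Require Import Defs.
From HB Require Import structures.
From mathcomp Require Import all_boot all_algebra.
From mathcomp Require Import reals.
From mathcomp Require Import complex mpoly.
From mathcomp Require Import ring.

Set Implicit Arguments.
Unset Strict Implicit.
Unset Printing Implicit Defensive.

Import GRing.Theory.
Local Open Scope ring_scope.
Local Open Scope quotient_scope.

(** * The projection onto the quotient by a principal ideal *)

Section QuotientProjection.
Variables (A : comNzRingType) (B : comAlgType A) (g : B).

Definition quot_pi (h : B) : principal_quot g := \pi_(principal_quot g) h.

Lemma quot_pi_is_zmod_morphism : zmod_morphism quot_pi.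
Proof.
move=> a b; apply/eqP; rewrite eq_sym subr_eq; apply/eqP.
by rewrite -principal_quot_piD subrK.
Qed.

Lemma quot_pi_is_monoid_morphism : monoid_morphism quot_pi.
Proof.
split; last by move=> a b; rewrite /quot_pi -principal_quot_piM.
by rewrite /quot_pi /GRing.one /= /principal_quot_one; unlock.
Qed.

Lemma quot_pi_is_scalable : scalable quot_pi.
Proof. by move=> a b; rewrite /quot_pi -principal_quot_piZ. Qed.

HB.instance Definition _ := GRing.isZmodMorphism.Build B (principal_quot g)
  quot_pi quot_pi_is_zmod_morphism.
HB.instance Definition _ := GRing.isMonoidMorphism.Build B (principal_quot g)
  quot_pi quot_pi_is_monoid_morphism.
HB.instance Definition _ := GRing.isScalable.Build A B (principal_quot g) _
  quot_pi quot_pi_is_scalable.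

Lemma quot_piP (a b : B) : quot_pi a = quot_pi b <-> exists q, a = b + q * g.
Proof.
split=> [/principal_quot_eqP/principal_idealP[q E]|[q ->]].
  by exists q; rewrite -E addrC subrK.
by apply/principal_quot_eqP/principal_idealP; exists q; rewrite addrC addKr.
Qed.

End QuotientProjection.

(** * Substitution of polynomials and a criterion for hyperplanes *)

Section Composition.
Variable A : comNzRingType.

Lemma quot_pi_comp m n (g : {mpoly A[m]}) (h : {mpoly A[n]})
    (lp lq : n.-tuple {mpoly A[m]}) :
  (forall i, quot_pi g (tnth lp i) = quot_pi g (tnth lq i)) ->
  quot_pi g (h \mPo lp) = quot_pi g (h \mPo lq).
Proof.
move=> E; rewrite !comp_mpolyE !raddf_sum /=; apply: eq_bigr => e _.
rewrite !linearZ /= !rmorph_prod; congr (_ *: _).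
by apply: eq_bigr => i _; rewrite !rmorphXn; congr (_ ^+ _); exact: E.
Qed.

Lemma comp_mpolyA n m l (h : {mpoly A[n]}) (lp : n.-tuple {mpoly A[m]})
    (lq : m.-tuple {mpoly A[l]}) :
  (h \mPo lp) \mPo lq = h \mPo [tuple tnth lp i \mPo lq | i < n].
Proof.
rewrite [h \mPo lp]comp_mpolyE [RHS]comp_mpolyE raddf_sum; apply: eq_bigr => e _.
rewrite /= comp_mpolyZ rmorph_prod; congr (_ *: _).
by apply: eq_bigr => i _; rewrite rmorphXn tnth_mktuple.
Qed.

Lemma comp_mpoly2A m l (h : {mpoly A[2]}) (a b : {mpoly A[m]})
    (lq : m.-tuple {mpoly A[l]}) :
  (h \mPo [tuple a; b]) \mPo lq = h \mPo [tuple a \mPo lq; b \mPo lq].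
Proof.
rewrite comp_mpolyA; congr (h \mPo _); apply: eq_from_tnth => i.
by rewrite tnth_mktuple; case: i => [[|[|[]]]].
Qed.

Lemma quot_pi_comp2 m (g : {mpoly A[m]}) (h : {mpoly A[2]})
    (a b a' b' : {mpoly A[m]}) :
  quot_pi g a = quot_pi g a' -> quot_pi g b = quot_pi g b' ->
  quot_pi g (h \mPo [tuple a; b]) = quot_pi g (h \mPo [tuple a'; b']).
Proof. by move=> Ea Eb; apply: quot_pi_comp => -[[|[|[]]]]. Qed.

Lemma comp_mpoly_at0 m n (h : {mpoly A[n]}) (lq : n.-tuple {mpoly A[m]}) :
  (forall i, tnth lq i = 0) -> h \mPo lq = (h.@[fun=> 0])%:MP.
Proof.
move=> E; rewrite comp_mpolyE mevalE rmorph_sum; apply: eq_bigr => e _.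
rewrite rmorphM /= mul_mpolyC rmorph_prod; congr (_ *: _).
by apply: eq_bigr => i _; rewrite E rmorphXn rmorph0.
Qed.

(** Substitution of [lp] kills [g], so it descends to the quotient. Algebra morphisms that agree on
    the variables are equal, so both inverse laws need checking on generators only. *)
Lemma hyperplane_of_inverse n (g : {mpoly A[n.+1]})
    (lp : n.+1.-tuple {mpoly A[n]}) (lq : n.-tuple {mpoly A[n.+1]}) :
  g \mPo lp = 0 ->
  (forall i, tnth lq i \mPo lp = 'X_i) ->
  (forall i, quot_pi g (tnth lp i \mPo lq) = quot_pi g 'X_i) ->
  hyperplane g.
Proof.
move=> g0 lqK lpK.
(* [F] evaluates a chosen representative; [Fpi] shows that the choice does not matter. *)
pose F (s : principal_quot g) := repr s \mPo lp.
have Fpi h : F (quot_pi g h) = h \mPo lp.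
  have /quot_piP[q E] : quot_pi g (repr (quot_pi g h)) = quot_pi g h.
    exact: reprK.
  by rewrite /F E rmorphD rmorphM /= g0 mulr0 addr0.
have piE s : exists h, s = quot_pi g h by exists (repr s); rewrite /quot_pi reprK.
have addF : zmod_morphism F.
  move=> s t; have [a ->] := piE s; have [b ->] := piE t.
  by rewrite -rmorphB !Fpi rmorphB.
have mulF : monoid_morphism F.
  split; first by rewrite -(rmorph1 (quot_pi g)) Fpi rmorph1.
  move=> s t; have [a ->] := piE s; have [b ->] := piE t.
  by rewrite -rmorphM !Fpi rmorphM.
pose aF := GRing.isZmodMorphism.Build _ _ F addF.
pose mF := GRing.isMonoidMorphism.Build _ _ F mulF.
pose FF : {rmorphism principal_quot g -> {mpoly A[n]}} := HB.pack F aF mF.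
exists FF; split.
  move=> a s; have [h ->] := piE s; rewrite -linearZ /= !Fpi; exact: linearZ.
exists (fun t => quot_pi g (t \mPo lq)) => [s|t] /=.
  have [h ->] := piE s; rewrite Fpi comp_mpolyA -[RHS]/(quot_pi g h).
  rewrite -[in RHS](comp_mpoly_id h); apply: quot_pi_comp => i.
  by rewrite !tnth_mktuple.
rewrite Fpi comp_mpolyA -[RHS]comp_mpoly_id; congr (t \mPo _).
by apply: eq_from_tnth => i; rewrite !tnth_mktuple.
Qed.

End Composition.

(** * Passing between (z, u) and (v, w) when y is given *)

(** As [x] is cancellable, y and (v, w) determine first p, by x^2 p = y w + v^2, then z, by x z = v
    - y p, and finally u. *)
Lemma ven_coords_inj (T : comPzRingType) (x y z u z' u' : T)
    (p := y * u + z ^+ 2) (p' := y * u' + z' ^+ 2) :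
  (forall s t : T, x * s = x * t -> s = t) ->
  x * z + y * p = x * z' + y * p' ->
  x ^+ 2 * u - 2%:R * x * z * p - y * p ^+ 2
    = x ^+ 2 * u' - 2%:R * x * z' * p' - y * p' ^+ 2 ->
  z = z' /\ u = u'.
Proof.
move=> xI; set v := x * z + _; set v' := x * z' + _ => Ev.
set w := _ - _; set w' := _ - _ => Ew.
have Ep : p = p'.
  apply/xI/xI.
  have -> : x * (x * p) = y * w + v ^+ 2 by rewrite /w /v /p; ring.
  by rewrite Ev Ew /w' /v' /p'; ring.
have Ez : z = z'.
  apply/xI; have -> : x * z = v - y * p by rewrite addrK.
  by rewrite Ev Ep addrK.
split=> //; apply/xI/xI.
have -> : x * (x * u) = w + 2%:R * x * z * p + y * p ^+ 2 by rewrite /w; ring.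
by rewrite Ew Ep Ez /w'; ring.
Qed.

Lemma ven_coords_morph (R1 R2 : comPzRingType) (T : comPzRingType)
    (F : {rmorphism R1 -> T}) (G : {rmorphism R2 -> T})
    (x y z u : R1) (x' y' z' u' : R2)
    (p := y * u + z ^+ 2) (p' := y' * u' + z' ^+ 2) :
  (forall s t : T, G x' * s = G x' * t -> s = t) ->
  F x = G x' -> F y = G y' ->
  F (x * z + y * p) = G (x' * z' + y' * p') ->
  F (x ^+ 2 * u - 2%:R * x * z * p - y * p ^+ 2)
    = G (x' ^+ 2 * u' - 2%:R * x' * z' * p' - y' * p' ^+ 2) ->
  F z = G z' /\ F u = G u'.
Proof.
move=> xI Ex Ey; rewrite /p /p'.
rewrite !(rmorph_nat, rmorphXn, rmorphB, rmorphD, rmorphM) Ex Ey.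
exact: ven_coords_inj.
Qed.

(** The identities that determine p and u are solved for them. Both solutions call for a division by
    [X ^+ 2], which is possible because [Y] times the dividend is a multiple of [X ^+ 2] and [Y] is
    a unit modulo [X ^+ 2]. *)
Lemma ven_coords_exist (T : comPzRingType) (X C D H V W Z : T) (Y := C - X * H) :
  (forall s t : T, X * s = X * t -> s = t) -> C * D = 1 ->
  X ^+ 2 * V - V ^+ 2 * Y - W * Y ^+ 2 = X ^+ 3 * Z ->
  exists U, let p := Y * U + Z ^+ 2 in
    X * Z + Y * p = V /\
    X ^+ 2 * U - 2%:R * X * Z * p - Y * p ^+ 2 = W.
Proof.
move=> XI CD EZ.
have X2I (s t : T) : X ^+ 2 * s = X ^+ 2 * t -> s = t.
  by rewrite -!mulrA => /XI/XI.
(* [(C + X H) Y = C^2 - X^2 H^2] and [C] is a unit, so [Y] is one modulo [X^2]. *)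
have dvdX2 M B : Y * M = X ^+ 2 * B -> exists M', X ^+ 2 * M' = M.
  move=> E; exists (D ^+ 2 * (H ^+ 2 * M + (C + X * H) * B)).
  transitivity (D ^+ 2 * (X ^+ 2 * H ^+ 2 * M + (C + X * H) * (Y * M))).
    by rewrite E; ring.
  by rewrite /Y; ring: CD.
have [p Ep] : exists p, X ^+ 2 * p = Y * W + V ^+ 2.
  apply: (@dvdX2 _ (V - X * Z)).
  have -> : X ^+ 2 * (V - X * Z) = X ^+ 2 * V - X ^+ 3 * Z by ring.
  by rewrite -EZ; ring.
have EV : X * Z + Y * p = V.
  apply: X2I.
  have -> : X ^+ 2 * (X * Z + Y * p) = X ^+ 3 * Z + Y * (X ^+ 2 * p) by ring.
  by rewrite -EZ Ep; ring.
(* The left factor is the value that [X ^+ 2 * U] must take, with [X * Z] replaced by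
   [V - Y * p]. *)
have YN : Y * (W + 2%:R * V * p - Y * p ^+ 2) = X ^+ 2 * (p - Z ^+ 2).
  have -> : X ^+ 2 * (p - Z ^+ 2) = X ^+ 2 * p - (V - Y * p) ^+ 2.
    by rewrite -EV; ring.
  by rewrite Ep; ring.
have [U EU] := dvdX2 _ _ YN.
exists U; have <- /= : p = Y * U + Z ^+ 2.
  apply: X2I; have -> : X ^+ 2 * (Y * U + Z ^+ 2) = Y * (X ^+ 2 * U) + X ^+ 2 * Z ^+ 2.
    by ring.
  by rewrite EU YN; ring.
by split=> //; rewrite EU -EV; ring.
Qed.

(** * The Nagata automorphism *)

Section Nagata.
Variable T : comPzRingType.
Implicit Types q a b v w : T.

(** The two moving components of the Nagata automorphism, its fixed variable being [- q]. It
    preserves [a ^+ 2 - q * b], so the inverse arises by reversing the sign of this invariant. *)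
Definition nagata1 q a b := a - q * (a ^+ 2 - q * b).
Definition nagata2 q a b :=
  b - 2%:R * a * (a ^+ 2 - q * b) + q * (a ^+ 2 - q * b) ^+ 2.

Definition nagata_inv1 q v w := v + q * (v ^+ 2 - q * w).
Definition nagata_inv2 q v w :=
  w + 2%:R * v * (v ^+ 2 - q * w) + q * (v ^+ 2 - q * w) ^+ 2.

Lemma nagata_invariant q a b :
  nagata1 q a b ^+ 2 - q * nagata2 q a b = a ^+ 2 - q * b.
Proof. by rewrite /nagata1 /nagata2; ring. Qed.

Lemma nagata_inv_invariant q v w :
  nagata_inv1 q v w ^+ 2 - q * nagata_inv2 q v w = v ^+ 2 - q * w.
Proof. by rewrite /nagata_inv1 /nagata_inv2; ring. Qed.

Lemma nagata1K q a b : nagata_inv1 q (nagata1 q a b) (nagata2 q a b) = a.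
Proof. by rewrite /nagata_inv1 nagata_invariant /nagata1 subrK. Qed.

Lemma nagata2K q a b : nagata_inv2 q (nagata1 q a b) (nagata2 q a b) = b.
Proof. by rewrite /nagata_inv2 nagata_invariant /nagata1 /nagata2; ring. Qed.

Lemma nagata_inv1K q v w : nagata1 q (nagata_inv1 q v w) (nagata_inv2 q v w) = v.
Proof. by rewrite /nagata1 nagata_inv_invariant /nagata_inv1 addrK. Qed.

Lemma nagata_inv2K q v w : nagata2 q (nagata_inv1 q v w) (nagata_inv2 q v w) = w.
Proof. by rewrite /nagata2 nagata_inv_invariant /nagata_inv1 /nagata_inv2; ring. Qed.

(** [Z] and [X * U] are the components of the inverse Nagata map with parameter [H] at (v, w).
    Modulo [X] the parameter is [q], and there the second component is [X * t]; hence it is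
    divisible by [X]. *)
Lemma nagata_ven_coords (X q s a t : T) (H := q + X * s)
    (v := nagata1 q a (X * t)) (w := nagata2 q a (X * t))
    (Y := - (X * H)) (Z := v + H * (v ^+ 2 - H * w)) :
  exists U, let p := Y * U + Z ^+ 2 in
    X * Z + Y * p = X * v /\
    X ^+ 2 * U - 2%:R * X * Z * p - Y * p ^+ 2 = X * w.
Proof.
pose p0 := v ^+ 2 - q * w; pose p := v ^+ 2 - H * w.
have Ep : p - p0 = - (X * s * w) by rewrite /p /p0 /H; ring.
(* The quotient by [X] of [w + 2 v p + H p^2], expanded around [nagata_inv2 q v w = X * t] by means
   of [H = q + X * s] and [Ep]. *)
exists (t + s * p ^+ 2 - (2%:R * v + q * (p + p0)) * s * w); set U := _ - _.
have EU : X * U = w + 2%:R * v * p + H * p ^+ 2.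
  have -> : X * U = X * t + X * s * p ^+ 2
                    + (2%:R * v + q * (p + p0)) * - (X * s * w).
    by rewrite /U; ring.
  rewrite -Ep -{1}(nagata2K q a (X * t)) -/v -/w /nagata_inv2 -/p0 /H.
  ring.
have -> : Y * U + Z ^+ 2 = p.
  have -> : Y * U = - (H * (X * U)) by rewrite /Y; ring.
  by rewrite EU /Z -/p [RHS](erefl : p = v ^+ 2 - H * w); ring.
rewrite /= exprS expr1 -!mulrA EU /Y /Z -/p.
by split; ring.
Qed.

(* Modulo g, v and w are the quotients by X of the polynomials ven_v and ven_w. *)
Lemma nagata_inv_ven_coords (X y z u H q s m : T) (p := y * u + z ^+ 2)
    (v := z - H * p) (w := X * u - 2%:R * z * p + H * p ^+ 2) (g := y + X * H) :
  H = q + X * s + m * g ->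
  exists t n, X * t = nagata_inv2 q v w + n * g.
Proof.
move=> EH; pose p0 := v ^+ 2 - q * w.
have Ep : p0 - p = X * s * w + (m * w - u) * g.
  have -> : p0 - p = (H - q) * w - u * g.
    have Ez : z ^+ 2 = p - y * u by rewrite addrC addKr.
    by rewrite /p0 /v /w /g; ring: Ez.
  by rewrite {1}EH; ring.
(* Since [X * u = w + 2 v p + H p^2], the difference [nagata_inv2 q v w - X * u] splits by [EH] and
   [Ep] into a multiple of [X], which goes into t, and a multiple of [g], which goes into n with the
   opposite sign. *)
exists (u + 2%:R * v * s * w + q * s * w * (p0 + p) - s * p ^+ 2).
exists (- ((m * w - u) * (2%:R * v + q * (p0 + p)) - m * p ^+ 2)).
apply/eqP; rewrite -subr_eq0; apply/eqP.
transitivity (X * u - (w + 2%:R * v * p + H * p ^+ 2)).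
  rewrite /nagata_inv2 -/p0 EH.
  have -> : p0 = p + (X * s * w + (m * w - u) * g) by rewrite -Ep addrC subrK.
  ring.
by rewrite /w /v; ring.
Qed.

End Nagata.

Lemma nagata1_morph (T1 T2 : comPzRingType) (F : {rmorphism T1 -> T2}) q a b :
  F (nagata1 q a b) = nagata1 (F q) (F a) (F b).
Proof. by rewrite /nagata1 !(rmorphXn, rmorphB, rmorphM). Qed.

Lemma nagata2_morph (T1 T2 : comPzRingType) (F : {rmorphism T1 -> T2}) q a b :
  F (nagata2 q a b) = nagata2 (F q) (F a) (F b).
Proof. by rewrite /nagata2 !(rmorph_nat, rmorphXn, rmorphB, rmorphD, rmorphM). Qed.

Lemma nagata_inv1_morph (T1 T2 : comPzRingType) (F : {rmorphism T1 -> T2}) q a b :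
  F (nagata_inv1 q a b) = nagata_inv1 (F q) (F a) (F b).
Proof. by rewrite /nagata_inv1 !(rmorphXn, rmorphB, rmorphD, rmorphM). Qed.

Lemma nagata_inv2_morph (T1 T2 : comPzRingType) (F : {rmorphism T1 -> T2}) q a b :
  F (nagata_inv2 q a b) = nagata_inv2 (F q) (F a) (F b).
Proof. by rewrite /nagata_inv2 !(rmorph_nat, rmorphXn, rmorphB, rmorphD, rmorphM). Qed.

(** * The hypersurface f = c and its parametrizations *)

Section Venereau.
Variable K : fieldType.
Local Notation k := {poly K}.
Local Notation S := {mpoly k[3]}.
Local Notation P := {mpoly k[2]}.
Local Notation x := (('X : k)%:MP).
Local Notation y := ('X_0 : S).
Local Notation z := ('X_1 : S).
Local Notation u := ('X_2 : S).
Local Notation p := (ven_p K).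
Local Notation v := (ven_v K).
Local Notation w := (ven_w K).

Lemma mpolyX_neq0 n : (x : {mpoly k[n]}) != 0.
Proof. by rewrite mpolyC_eq0 polyX_eq0. Qed.

Lemma mulXI n m : injective (fun a : {mpoly k[n]} => x ^+ m * a).
Proof. by move=> a b; apply/mulfI/expf_neq0/mpolyX_neq0. Qed.

Definition ven_poly (h : P) (c : K) : S :=
  y + x * (h \mPo [tuple v; w]) - (c%:P)%:MP.

Lemma dvd_mpolyX n (r : {mpoly k[n]}) :
  map_mpoly (horner_eval (0 : K)) r = 0 -> exists s, r = x * s.
Proof.
move=> r0; exists (\sum_(m <- msupp r) (r@_m %/ 'X)%:MP * 'X_[m]).
rewrite mulr_sumr [LHS]mpolyE; apply: eq_bigr => m _.
rewrite mulrA -mpolyCM mul_mpolyC; congr (_ *: _).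
rewrite mulrC divpK //.
rewrite -['X]subr0 -polyC0 dvdp_XsubCl /root.
have := congr1 (mcoeff m) r0; rewrite mcoeff_map_mpoly mcoeff0.
by rewrite /= /horner_eval => ->.
Qed.

Lemma ven_poly_modX h c :
  map_mpoly (horner_eval (0 : K)) (ven_poly h c) != 0.
Proof.
rewrite /ven_poly rmorphB rmorphD rmorphM /= !map_mpolyC map_mpolyX.
rewrite /= /horner_eval hornerX hornerC mpolyC0 mul0r addr0.
apply/eqP => /(congr1 (mcoeff U_(0))) /eqP.
by rewrite mcoeffB mcoeffX mcoeffC mcoeff0 eqxx mnm1_eq0 mulr0 subr0 oner_eq0.
Qed.

(** At x = 0 the polynomial becomes y - c, which is nonzero in the domain K[y,z,u]; so if x divides
    a multiple of [ven_poly h c], it divides the cofactor. *)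
Lemma quot_pi_mulXI h c (s t : principal_quot (ven_poly h c)) :
  quot_pi (ven_poly h c) x * s = quot_pi (ven_poly h c) x * t -> s = t.
Proof.
rewrite -[s]reprK -[t]reprK -!/(quot_pi _ _) -!rmorphM => /quot_piP[q E].
apply/quot_piP; move: (repr s) (repr t) E => a b E.
have /eqP : map_mpoly (horner_eval (0 : K)) (q * ven_poly h c) = 0.
  have -> : q * ven_poly h c = x * (a - b) by rewrite [RHS]mulrBr E; ring.
  by rewrite rmorphM /= map_mpolyC /= /horner_eval hornerX mpolyC0 mul0r.
rewrite rmorphM mulf_eq0 (negPf (ven_poly_modX h c)) orbF => /eqP/dvd_mpolyX[r Er].
by exists r; apply: (mulfI (mpolyX_neq0 3)); rewrite E Er; ring.
Qed.

Lemma ven_comp m (Y Z U : {mpoly k[m]}) (lp := [tuple Y; Z; U])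
    (p' := Y * U + Z ^+ 2) :
  [/\ p \mPo lp = p',
      v \mPo lp = x * Z + Y * p'
    & w \mPo lp = x ^+ 2 * U - 2%:R * x * Z * p' - Y * p' ^+ 2].
Proof.
have Ep : p \mPo lp = p'.
  by rewrite /ven_p rmorphD rmorphM rmorphXn /= !comp_mpolyXU.
rewrite /ven_v /ven_w /ven_x /ven_y /ven_z /ven_u.
move: (ven_p K) Ep => q Eq.
rewrite !(rmorphB, rmorphD, rmorphXn, rmorph_nat, rmorphM) /= Eq.
by rewrite !comp_mpolyXU !comp_mpolyC.
Qed.

Lemma ven_poly_comp h c m (lp : 3.-tuple {mpoly k[m]}) (V W : {mpoly k[m]}) :
  tnth lp 0 = (c%:P)%:MP - x * (h \mPo [tuple V; W]) ->
  v \mPo lp = V -> w \mPo lp = W -> ven_poly h c \mPo lp = 0.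
Proof.
move=> EY Ev Ew.
rewrite /ven_poly rmorphB rmorphD rmorphM /= comp_mpoly2A Ev Ew.
by rewrite comp_mpolyXU !comp_mpolyC -tnth_nth EY subrK subrr.
Qed.

(** Modulo [ven_poly h c] it suffices that v and w are recovered: then so is y = c - x h(v, w), and
    [ven_coords_morph] gives z and u because x is cancellable in the quotient. *)
Lemma hyperplane_ven_poly (h : P) (c : K) (V W Y Z U : P) (a t : S) :
  Y = (c%:P)%:MP - x * (h \mPo [tuple V; W]) ->
  v \mPo [tuple Y; Z; U] = V -> w \mPo [tuple Y; Z; U] = W ->
  a \mPo [tuple Y; Z; U] = 'X_0 -> t \mPo [tuple Y; Z; U] = 'X_1 ->
  quot_pi (ven_poly h c) (V \mPo [tuple a; t]) = quot_pi (ven_poly h c) v ->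
  quot_pi (ven_poly h c) (W \mPo [tuple a; t]) = quot_pi (ven_poly h c) w ->
  hyperplane (ven_poly h c).
Proof.
move=> EY Ev Ew Ea Et; set g := ven_poly h c; set lq := [tuple a; t] => Vv Ww.
set lp := [tuple Y; Z; U] in Ev Ew Ea Et *.
have [Ep] := ven_comp Y Z U; rewrite -/lp Ev Ew; set p' := Y * U + _ => EV EW.
have g0 : g \mPo lp = 0 by exact: (ven_poly_comp (lp := lp) EY Ev Ew).
apply: (hyperplane_of_inverse g0 (lq := lq)) => [[[|[|[]]]]|] //= i.
have Yy : quot_pi g (Y \mPo lq) = quot_pi g y.
  rewrite EY rmorphB rmorphM /= comp_mpoly2A !comp_mpolyC !rmorphB !rmorphM /=.
  rewrite (quot_pi_comp2 h Vv Ww) -rmorphM -rmorphB.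
  by apply/quot_piP; exists (-1); rewrite /g /ven_poly; ring.
pose F : {rmorphism P -> principal_quot g} := quot_pi g \o comp_mpoly lq.
have Fx : F x = quot_pi g x by rewrite /F /= comp_mpolyC.
rewrite EV in Vv; rewrite EW in Ww.
have [Zz Uu] :=
  ven_coords_morph (F := F) (G := quot_pi g) (@quot_pi_mulXI h c) Fx Yy Vv Ww.
by case: i => [[|[|[|[]]]]] // i; rewrite ?Yy ?Zz ?Uu //.
Qed.

(** * The case of nonzero c *)

Definition ven_Y m (h : P) (c : K) (V W : {mpoly k[m]}) :=
  (c%:P)%:MP - x * (h \mPo [tuple V; W]).

(* On the hypersurface ven_poly h c = 0 one has y = ven_Y h c v w and
   x^3 z = ven_x3z h c v w. *)
Definition ven_x3z m (h : P) (c : K) (V W : {mpoly k[m]}) :=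
  x ^+ 2 * V - V ^+ 2 * ven_Y h c V W - W * ven_Y h c V W ^+ 2.

Lemma ven_Y_comp m l (h : P) c (V W : {mpoly k[m]}) (lq : m.-tuple {mpoly k[l]}) :
  ven_Y h c V W \mPo lq = ven_Y h c (V \mPo lq) (W \mPo lq).
Proof. by rewrite /ven_Y rmorphB rmorphM /= comp_mpoly2A !comp_mpolyC. Qed.

Lemma ven_x3z_comp m l (h : P) c (V W : {mpoly k[m]}) (lq : m.-tuple {mpoly k[l]}) :
  ven_x3z h c V W \mPo lq = ven_x3z h c (V \mPo lq) (W \mPo lq).
Proof.
rewrite /ven_x3z -ven_Y_comp; move: (ven_Y h c V W) => Y.
by rewrite !(rmorphB, rmorphXn, rmorphM) /= comp_mpolyC.
Qed.

(** A difference quotient in the second argument. Modulo x, [ven_Y] is the constant c, so only the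
    term [- W * c^2] varies with W. *)
Lemma ven_x3z_sub m (h : P) c (V W W' : {mpoly k[m]}) :
  exists r, ven_x3z h c V W - ven_x3z h c V W'
            = (W - W') * (x * r - (c%:P)%:MP ^+ 2).
Proof.
(* Working modulo [W - W'] yields the divided difference [q] of h. *)
have /quot_piP[q] : quot_pi (W - W') (h \mPo [tuple V; W])
                    = quot_pi (W - W') (h \mPo [tuple V; W']).
  by apply: quot_pi_comp2 => //; apply/quot_piP; exists 1; rewrite mul1r addrC subrK.
rewrite /ven_x3z /ven_Y.
move: (h \mPo _) (h \mPo _) (x : {mpoly k[m]}) (c%:P%:MP) => H' H X C ->.
exists (V ^+ 2 * q + W' * q * (2%:R * C - X * H' - X * (H' + q * (W - W')))
  + 2%:R * C * (H' + q * (W - W')) - X * (H' + q * (W - W')) ^+ 2).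
ring.
Qed.

(* Newton iteration: by ven_x3z_sub the derivative in W is - c^2 modulo x. *)
Lemma ven_hensel m (h : P) c (V : {mpoly k[m]}) N : c != 0 ->
  exists W E, ven_x3z h c V W = x ^+ N * E.
Proof.
move=> c0; elim: N => [|N [W [E EW]]].
  by exists 0, (ven_x3z h c V 0); rewrite mul1r.
pose W' := W + (c^-1%:P)%:MP ^+ 2 * (x ^+ N * E).
have [r] := ven_x3z_sub h c V W' W.
have cV : (c%:P)%:MP * (c^-1%:P)%:MP = 1 :> {mpoly k[m]}.
  by rewrite -!rmorphM mulfV // !rmorph1.
move/(canRL (subrK _)); rewrite EW => EW'.
exists W', ((c^-1%:P)%:MP ^+ 2 * r * E); rewrite EW' /W'.
move: (x : {mpoly k[m]}) (c%:P%:MP) (c^-1%:P%:MP) cV => X C D cV.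
rewrite (exprSr X); move: (X ^+ N) => XN.
ring: cV.
Qed.

Lemma ven_point_exists m (h : P) (c : K) (V W Z : {mpoly k[m]}) :
  c != 0 -> ven_x3z h c V W = x ^+ 3 * Z ->
  exists U, let lp := [tuple ven_Y h c V W; Z; U] in
    v \mPo lp = V /\ w \mPo lp = W.
Proof.
move=> c0 EZ; rewrite /ven_Y.
have cV : (c%:P)%:MP * (c^-1%:P)%:MP = 1 :> {mpoly k[m]}.
  by rewrite -!rmorphM mulfV // !rmorph1.
have [U [EV EW]] := ven_coords_exist (@mulfI _ _ (mpolyX_neq0 m)) cV EZ.
by exists U; have [_ -> ->] := ven_comp (c%:P%:MP - x * (h \mPo [tuple V; W])) Z U.
Qed.

(** Modulo [ven_poly h c], comparing [ven_x3z] at w and at [B] shows that x^3 divides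
    [(w - B) * (x * r - c^2)], whose last factor is a unit modulo x^3. *)
Lemma ven_w_correction (h : P) (c : K) (B E : S) :
  c != 0 -> ven_x3z h c v B = x ^+ 3 * E ->
  exists t q, x ^+ 3 * t = w - B + q * ven_poly h c.
Proof.
move=> c0 EB; set g := ven_poly h c.
have cV : (c%:P)%:MP * (c^-1%:P)%:MP = 1 :> S.
  by rewrite -!rmorphM mulfV // !rmorph1.
have [r] := ven_x3z_sub h c v w B; rewrite EB.
have [q ->] : exists q, ven_x3z h c v w = x ^+ 3 * z + q * g.
  exists (v ^+ 2 + w * (y + ven_Y h c v w)).
  have EY : ven_Y h c v w = y - g.
    by rewrite /ven_Y /g /ven_poly opprB addrCA opprD addNKr.
  have -> : x ^+ 3 * z = x ^+ 2 * v - v ^+ 2 * y - w * y ^+ 2.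
    by rewrite /ven_w /ven_v /ven_p /ven_x /ven_y /ven_z; ring.
  rewrite /ven_x3z EY; move: (v) (w) (g) (y) (x : S) => v' w' g' y' x'.
  by ring.
move: (w - _) (g) (z) (x : S) (c%:P%:MP) (c^-1%:P%:MP) cV.
move=> d g' z' X C D CD Er.
(* From [(C^2 - X r) * n = C^6 - X^3 r^3] it follows that [D ^+ 6 * n] inverts [C^2 - X r] modulo
   [X ^+ 3]. *)
pose n := C ^+ 4 + C ^+ 2 * X * r + X ^+ 2 * r ^+ 2.
exists (D ^+ 6 * ((E - z') * n + d * r ^+ 3)), (D ^+ 6 * q * n).
have {}Er : X ^+ 3 * (E - z') = d * (C ^+ 2 - X * r) + q * g'.
  by rewrite -[C ^+ 2 - _]opprB mulrN -Er; ring.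
transitivity (D ^+ 6 * (X ^+ 3 * (E - z') * n + X ^+ 3 * d * r ^+ 3)).
  by ring.
rewrite Er /n; ring: CD.
Qed.

Lemma hyperplane_ven_unit (h : P) (c : K) : c != 0 -> hyperplane (ven_poly h c).
Proof.
move=> c0.
(* Solving over one free variable gives a single [b] that can be evaluated both at the parameter
   ['X_0] and at v. *)
have [b [e Eb]] := ven_hensel h ('X_0 : {mpoly k[1]}) 3 c0.
have bcomp m (V : {mpoly k[m]}) :
    ven_x3z h c V (b \mPo [tuple V]) = x ^+ 3 * (e \mPo [tuple V]).
  have := congr1 (comp_mpoly [tuple V]) Eb.
  by rewrite ven_x3z_comp rmorphM rmorphXn /= comp_mpolyC comp_mpolyXU.
have tcomp m (V : {mpoly k[m]}) l (lq : m.-tuple {mpoly k[l]}) :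
    (b \mPo [tuple V]) \mPo lq = b \mPo [tuple V \mPo lq].
  rewrite comp_mpolyA; congr (b \mPo _); apply: eq_from_tnth => i.
  by rewrite tnth_mktuple ord1.
have [V EV] : exists V : P, V = 'X_0 by exists 'X_0.
(* The parameter ['X_1] stands for (w - b(v)) / x^3. *)
have [W WB] : exists W : P, W - (b \mPo [tuple V]) = x ^+ 3 * 'X_1.
  by exists (x ^+ 3 * 'X_1 + (b \mPo [tuple V])); rewrite addrK.
have [Z EZ] : exists Z, ven_x3z h c V W = x ^+ 3 * Z.
  have [r] := ven_x3z_sub h c V W (b \mPo [tuple V]).
  rewrite bcomp WB => /(canRL (subrK _)) ->.
  exists ('X_1 * (x * r - c%:P%:MP ^+ 2) + (e \mPo [tuple V])).
  by rewrite [RHS]mulrDr mulrA.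
have [U [Ev Ew]] := ven_point_exists c0 EZ.
have g0 : ven_poly h c \mPo [tuple ven_Y h c V W; Z; U] = 0.
  exact: (ven_poly_comp _ Ev Ew).
have [t [q Et]] := ven_w_correction c0 (bcomp 3 v).
have Vlq : V \mPo [tuple v; t] = v by rewrite EV comp_mpolyXU.
apply: (hyperplane_ven_poly (V := V) (W := W) (a := v) (t := t) _ Ev Ew).
- by [].
- by rewrite Ev.
- apply: (@mulXI 2 3); have := congr1 (comp_mpoly [tuple ven_Y h c V W; Z; U]) Et.
  rewrite rmorphM rmorphXn /= comp_mpolyC => ->.
  rewrite rmorphD rmorphB rmorphM /= g0 mulr0 addr0 tcomp Ew Ev.
  exact: WB.
- by rewrite Vlq.
- apply/quot_piP; exists q; move/(canRL (subrK _)): WB => ->.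
  rewrite rmorphD rmorphM rmorphXn /= comp_mpolyC tcomp Vlq comp_mpolyXU /= Et.
  by rewrite addrAC subrK.
Qed.

(** * The case c = 0 *)

(** Provides the form [q + X * s], with q = h(0, 0), that the Nagata lemmas require. *)
Lemma comp_mpoly2_modX m (h : P) (V W : {mpoly k[m]}) :
  exists s, h \mPo [tuple x * V; x * W] = (h.@[fun=> 0])%:MP + x * s.
Proof.
have E (A : {mpoly k[m]}) : quot_pi (x : {mpoly k[m]}) (x * A) = quot_pi x 0.
  by apply/quot_piP; exists A; rewrite add0r mulrC.
have /quot_piP[s ->] := quot_pi_comp2 h (E V) (E W).
exists s; rewrite (comp_mpoly_at0 h (lq := [tuple 0; 0])) 1?mulrC //.
by case=> [[|[|[]]]].
Qed.

Lemma hyperplane_ven_zero (h : P) : hyperplane (ven_poly h 0).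
Proof.
set g := ven_poly h 0.
pose q n : {mpoly k[n]} := (h.@[fun=> 0])%:MP.
have qC n m (lp : n.-tuple {mpoly k[m]}) : q n \mPo lp = q m by exact: comp_mpolyC.
have xC n m (lp : n.-tuple {mpoly k[m]}) : x \mPo lp = x by exact: comp_mpolyC.
have [b Eb] : exists b : P, b = x * 'X_1 by exists (x * 'X_1).
have [vP EvP] : exists vP, vP = nagata1 (q 2%N) 'X_0 b.
  by exists (nagata1 (q 2%N) 'X_0 b).
have [wP EwP] : exists wP, wP = nagata2 (q 2%N) 'X_0 b.
  by exists (nagata2 (q 2%N) 'X_0 b).
have [s Es] := comp_mpoly2_modX h vP wP.
have := nagata_ven_coords x (q 2%N) s 'X_0 'X_1.
rewrite -Eb -EvP -EwP -Es => -[U].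
set Y := - _; set Z := vP + _ => -[Ev Ew].
have [_] := ven_comp Y Z U; rewrite Ev Ew; set lp := [tuple Y; Z; U].
move=> {}Ev {}Ew.
have EY : Y = (0%:P)%:MP - x * (h \mPo [tuple x * vP; x * wP]).
  by rewrite !rmorph0 sub0r.
have g0 : g \mPo lp = 0 by exact: (ven_poly_comp (lp := lp) EY Ev Ew).
have [H EH] : exists H, H = h \mPo [tuple v; w] by exists (h \mPo [tuple v; w]).
have Eg : g = y + x * H by rewrite EH /g /ven_poly !rmorph0 subr0.
(* Replacing y by - x H makes v and w divisible by x modulo [g]; these are the quotients. *)
pose vS := z - H * p; pose wS := x * u - 2%:R * z * p + H * p ^+ 2.
have EvS : x * vS = v - p * g.
  by rewrite /vS Eg /ven_v /ven_x /ven_y /ven_z; move: (p) => p1; ring.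
have EwS : x * wS = w + p ^+ 2 * g.
  by rewrite /wS Eg /ven_w /ven_x /ven_y /ven_z /ven_u; move: (p) => p1; ring.
have piv : quot_pi g (x * vS) = quot_pi g v.
  by apply/quot_piP; exists (- p); rewrite EvS mulNr.
have piw : quot_pi g (x * wS) = quot_pi g w.
  by apply/quot_piP; exists (p ^+ 2); rewrite EwS.
have [t [n Et]] : exists t n, x * t = nagata_inv2 (q 3) vS wS + n * g.
  have [s' Es'] := comp_mpoly2_modX h vS wS.
  (* Here [m] measures h(v, w) against h(x vS, x wS) modulo [g]. *)
  have /esym/quot_piP[m] := quot_pi_comp2 h piv piw.
  rewrite -EH Es' Eg; exact: nagata_inv_ven_coords.
have Ephiv : vS \mPo lp = vP.
  apply: (@mulXI 2 1); rewrite !expr1 -Ev -(xC _ _ lp) -rmorphM EvS.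
  by rewrite rmorphB rmorphM /= g0 mulr0 subr0.
have Ephiw : wS \mPo lp = wP.
  apply: (@mulXI 2 1); rewrite !expr1 -Ew -(xC _ _ lp) -rmorphM EwS.
  by rewrite rmorphD rmorphM /= g0 mulr0 addr0.
(* Modulo [g], (a, x t) is the inverse Nagata image of (vS, wS), so [F] followed by the Nagata
   formulas returns vS and wS. *)
pose a := nagata_inv1 (q 3) vS wS.
pose F : {rmorphism P -> principal_quot g} := quot_pi g \o comp_mpoly [tuple a; t].
have Fx : F x = quot_pi g x by rewrite /F /= xC.
have Fq : F (q 2%N) = quot_pi g (q 3) by rewrite /F /= qC.
have Fa : F 'X_0 = quot_pi g a by rewrite /F /= comp_mpolyXU.
have Fb : F b = quot_pi g (nagata_inv2 (q 3) vS wS).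
  rewrite Eb /F /= rmorphM /= xC comp_mpolyXU /= Et.
  by apply/quot_piP; exists n.
apply: (hyperplane_ven_poly EY Ev Ew (a := a) (t := t)).
- rewrite -/lp /a -[LHS]/(comp_mpoly lp _) nagata_inv1_morph /= qC Ephiv Ephiw.
  by rewrite EvP EwP nagata1K.
- apply: (@mulXI 2 1); rewrite !expr1 -{1}(xC _ _ lp) -rmorphM Et.
  rewrite rmorphD rmorphM /= g0 mulr0 addr0 -[LHS]/(comp_mpoly lp _) nagata_inv2_morph /= qC Ephiv Ephiw.
  by rewrite EvP EwP nagata2K.
- rewrite -[LHS]/(F _) rmorphM Fx EvP nagata1_morph Fq Fa Fb -nagata1_morph.
  by rewrite nagata_inv1K -rmorphM.
- rewrite -[LHS]/(F _) rmorphM Fx EwP nagata2_morph Fq Fa Fb -nagata2_morph.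
  by rewrite nagata_inv2K -rmorphM.
Qed.

End Venereau.

Theorem theorem22 (R : realType) (f : {mpoly {poly R[i]}[3]})
    (hf : venereau_type f) (c : R[i]) :
  hyperplane (f - (c%:P)%:MP).
Proof.
case: hf => Q [h ->] ->; rewrite -[_ - _]/(ven_poly h c).
have [->|c0] := eqVneq c 0; first exact: hyperplane_ven_zero.
exact: hyperplane_ven_unit.
Qed.
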